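(* Let $\Bbbk$ be a field of positive characteristic, let $n\ge 2$, and let $\sigma=(f_1,\dots,f_{n-1})$ be a sequence of algebraically independent homogeneous polynomials in $\Bbbk[x_0,\dots,x_n]$ whose Jacobian matrix has rank $n-1$. Let $\nabla(\sigma):\mathcal{O}_{\mathbb{P}^n}^{\oplus(n+1)}\to\bigoplus_{i=1}^{n-1}\mathcal{O}_{\mathbb{P}^n}(\deg(f_i)-1)$ be the morphism given by the Jacobian matrix, whose $i$-th row consists of the partial derivatives of $f_i$, and let $\mathcal{T}_\sigma=\ker(\nabla(\sigma))$. If $\mathrm{char}(\Bbbk)$ divides $\deg(f_i)$ for each $i=1,\dots,n-1$, then $$\mathcal{T}_\sigma\simeq\mathcal{O}_{\mathbb{P}^n}(-1)\oplus\mathcal{O}_{\mathbb{P}^n}(-d),$$ with $$d=\sum_{i=1}^{n-1}\deg(f_i)-(n-1)-\deg\Big(\gcd\big(\bigwedge\nabla(\sigma)\big)\Big)+1.$$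
   Context: $\mathbb{P}^n=\mathrm{Proj}(\Bbbk[x_0,\dots,x_n])$. $\bigwedge\nabla(\sigma)$ denotes the maximal (i.e. $(n-1)\times(n-1)$) minors of the Jacobian matrix $\nabla(\sigma)$, and $\gcd(\bigwedge\nabla(\sigma))$ denotes their greatest common divisor, a homogeneous polynomial defined up to a nonzero scalar.
   Formalization: The formula for d is corrected: its final ''+1'' is replaced by ''−1'', i.e. d = Σ deg(f_i) − (n−1) − deg(gcd) − 1; the printed formula fails, e.g. for char 2, n = 2, σ = (x_0x_1), where T_σ ≅ O(−1) ⊕ O. *)

(* Defs.v *)
From HB Require Import structures.
From mathcomp Require Export all_boot all_order all_algebra.
From mathcomp Require Export mpoly.

Set Implicit Arguments.
Unset Strict Implicit.
Unset Printing Implicit Defensive.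

Import Order.TTheory GRing.Theory Num.Theory.
Local Open Scope ring_scope.

Notation "x %:F" := (@FracField.tofrac _ x) : ring_scope.

(* The total degree; the value at 0 is the junk value 0. *)
Definition mpdeg (k : fieldType) (m : nat) (p : {mpoly k[m]}) : nat :=
  (msize p).-1.

Definition alg_independent (k : fieldType) (m r : nat)
    (sigma : r.-tuple {mpoly k[m]}) : Prop :=
  forall P : {mpoly k[r]}, P \mPo sigma = 0 -> P = 0.

Definition jacobian (k : fieldType) (m r : nat)
    (sigma : r.-tuple {mpoly k[m]}) : 'M[{mpoly k[m]}]_(r, m) :=
  \matrix_(i < r, j < m) (tnth sigma i)^`M(j).

(* The rank of a matrix over a domain is its rank over the fraction field. *)
Definition rank_frac (D : idomainType) (r c : nat) (A : 'M[D]_(r, c)) : nat :=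
  \rank (map_mx (@FracField.tofrac D) A).

Definition maximal_minor (D : idomainType) (r c : nat) (A : 'M[D]_(r, c))
    (a : D) : Prop :=
  exists h : 'I_r -> 'I_c,
    {homo h : i j / (i < j)%N} /\ a = \det (colsub h A).

Definition divides (D : idomainType) (a b : D) : Prop := exists q, b = q * a.

Definition is_gcd (D : idomainType) (A : D -> Prop) (g : D) : Prop :=
  (forall a, A a -> divides g a) /\
  (forall h, (forall a, A a -> divides h a) -> divides h g).

Section ProjectiveSpace.
Variables (k : fieldType) (n : nat).
Local Notation S := {mpoly k[n.+1]}.
Local Notation K := {fraction S}.

Definition homogeneous_ideal (I : S -> Prop) : Prop :=
  [/\ I 0,
      forall a b, I a -> I b -> I (a + b),
      forall a b, I b -> I (a * b)
    & forall e a, I a -> I (pihomog mdeg e a)].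

(* P^n = Proj S: the homogeneous primes not containing the irrelevant ideal *)
Record Pn : Type := PnPoint {
  pt_ideal :> S -> Prop;
  pt_homog : homogeneous_ideal pt_ideal;
  pt_proper : ~ pt_ideal 1;
  pt_prime : forall a b, pt_ideal (a * b) -> pt_ideal a \/ pt_ideal b;
  pt_relevant : exists i : 'I_n.+1, ~ pt_ideal 'X_i }.

Definition zariski_open (U : Pn -> Prop) : Prop :=
  exists2 I : S -> Prop, homogeneous_ideal I &
    forall x : Pn, U x <-> exists2 a, I a & ~ x a.

Definition included (V U : Pn -> Prop) : Prop := forall x, V x -> U x.

Definition eq_on (T : Type) (U : Pn -> Prop) (s t : Pn -> T) : Prop :=
  forall x, U x -> s x = t x.

(* Sections over U of O(m): functions sending x in U to an element of the      *)
(* degree m part of the homogeneous localization of S at x, locally given by   *)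
(* one fraction.  As S is a domain, all the localizations are taken inside     *)
(* K = Frac S.  Functions are defined on all of P^n, but only their values on  *)
(* U matter: two sections over U are the same when they are related by eq_on U *)
Definition twist_section (m : int) (U : Pn -> Prop) (s : Pn -> K) : Prop :=
  forall x, U x ->
  exists V : Pn -> Prop, [/\ zariski_open V, V x, included V U &
  exists (a b : S) (da db : nat),
    [/\ a \is da.-homog, b \is db.-homog, da%:Z = db%:Z + m &
        forall y, V y -> ~ y b /\ s y = a%:F / b%:F]].

(* Sheaves of O-modules whose sections are functions with values in K^r,       *)
(* with pointwise operations; this covers sums of line bundles and kernels of  *)
(* morphisms between them.                                                     *)
Record omodule : Type := OModule {
  orank : nat;
  osec : (Pn -> Prop) -> (Pn -> 'cV[K]_orank) -> Prop;
  osec_eq : forall U s t, zariski_open U -> eq_on U s t ->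
    osec U s -> osec U t;
  osec_res : forall U V s, zariski_open U -> zariski_open V ->
    included V U -> osec U s -> osec V s;
  osec_glue : forall U s, zariski_open U ->
    (forall x, U x ->
       exists V, [/\ zariski_open V, V x, included V U & osec V s]) ->
    osec U s;
  osec0 : forall U, zariski_open U -> osec U (fun=> 0);
  osec_lin : forall U c s t, zariski_open U ->
    twist_section 0 U c -> osec U s -> osec U t ->
    osec U (fun x => c x *: s x + t x) }.

Arguments osec : clear implicits.

Record omorphism (F G : omodule) : Type := OMorphism {
  omap :> (Pn -> Prop) -> (Pn -> 'cV[K]_(orank F)) ->
          (Pn -> 'cV[K]_(orank G));
  omap_sec : forall U s, zariski_open U -> osec F U s -> osec G U (omap U s);
  (* compatibility with restrictions and, for V = U, with equality on U *)
  omap_res : forall U V s t, zariski_open U -> zariski_open V ->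
    included V U -> osec F U s -> osec F V t -> eq_on V s t ->
    eq_on V (omap U s) (omap V t);
  omap_lin : forall U c s t, zariski_open U ->
    twist_section 0 U c -> osec F U s -> osec F U t ->
    eq_on U (omap U (fun x => c x *: s x + t x))
            (fun x => c x *: omap U s x + omap U t x) }.

Definition oisomorphic (F G : omodule) : Prop :=
  exists (phi : omorphism F G) (psi : omorphism G F),
  forall U, zariski_open U ->
    (forall s, osec F U s -> eq_on U (psi U (phi U s)) s) /\
    (forall t, osec G U t -> eq_on U (phi U (psi U t)) t).

Lemma included_refl U : included U U. Proof. by []. Qed.

Lemma zariski_openT : zariski_open (fun=> True).
Proof.
exists (fun=> True); first by split.
by move=> x; split=> // _; exists 1 => //; exact: pt_proper.
Qed.

Lemma zariski_openI U V : zariski_open U -> zariski_open V ->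
  zariski_open (fun x => U x /\ V x).
Proof.
move=> [I hI UI] [J hJ VJ]; exists (fun a => I a /\ J a).
  case: hI => I0 ID IM IH; case: hJ => J0 JD JM JH; split.
  - by split.
  - by move=> a b [? ?] [? ?]; split; [exact: ID | exact: JD].
  - by move=> a b [? ?]; split; [exact: IM | exact: JM].
  - by move=> e a [? ?]; split; [exact: IH | exact: JH].
move=> x; split.
  case=> /UI [a Ia xa] /VJ [b Jb xb]; exists (a * b).
    split; first by rewrite mulrC; case: hI => _ _ IM _; exact: IM.
    by case: hJ => _ _ JM _; exact: JM.
  by case/pt_prime.
by move=> [a [Ia Ja] xa]; split; [apply/UI; exists a | apply/VJ; exists a].
Qed.

Lemma pt0 (x : Pn) : x 0. Proof. by case: (pt_homog x). Qed.

Lemma pt_neq0 (x : Pn) b : ~ x b -> b%:F != 0 :> K.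
Proof.
by move=> xb; rewrite tofrac_eq0; apply/eqP => b0; apply: xb; rewrite b0; exact: pt0.
Qed.

Lemma twist_eq m U s t : eq_on U s t -> twist_section m U s ->
  twist_section m U t.
Proof.
move=> est hs x /hs [V [oV Vx sVU [a [b [da [db [ha hb e h]]]]]]].
exists V; split=> //; exists a, b, da, db; split=> // y Vy.
by rewrite -est; [exact: h | exact: sVU].
Qed.

Lemma twist_res m U V s : zariski_open V -> included V U ->
  twist_section m U s -> twist_section m V s.
Proof.
move=> oV sVU hs x Vx.
have [W [oW Wx sWU [a [b [da [db [ha hb e h]]]]]]] := hs _ (sVU _ Vx).
exists (fun x => V x /\ W x); split=> //; first exact: zariski_openI.
  by move=> y [].
by exists a, b, da, db; split=> // y [_ /h].
Qed.

Lemma twist_glue m U s :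
  (forall x, U x -> exists V : Pn -> Prop,
     [/\ zariski_open V, V x, included V U & twist_section m V s]) ->
  twist_section m U s.
Proof.
move=> hs x /hs [V [oV Vx sVU /(_ x Vx) [W [oW Wx sWV h]]]].
by exists W; split=> // y /sWV /sVU.
Qed.

Lemma twist0 m U : zariski_open U -> twist_section m U (fun=> 0).
Proof.
move=> oU x Ux; have [i xi] := pt_relevant x.
pose e := `|m|%N.
have xie : ~ x ('X_i ^+ e).
  elim: e => [|e IH]; first by rewrite expr0; exact: pt_proper.
  by rewrite exprS; case/pt_prime.
have hXe : ('X_i ^+ e : S) \is e.-homog.
  have hX : ('X_i : S) \is 1.-homog by rewrite dhomogX /= mdeg1.
  by have := dhomogMn e hX; rewrite mul1n.
have oJ : zariski_open (fun y => ~ y ('X_i ^+ e)).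
  exists (fun a => divides ('X_i ^+ e) a); last first.
    move=> y; split; first by exists ('X_i ^+ e) => //; exists 1; rewrite mul1r.
    case=> a [q ->] ya yX; apply: ya.
    by case: (pt_homog y) => _ _ yM _; exact: yM.
  split.
  - by exists 0; rewrite mul0r.
  - by move=> a b [q ->] [r ->]; exists (q + r); rewrite mulrDl.
  - by move=> a b [q ->]; exists (a * q); rewrite mulrA.
  move=> d a [q ->].
  rewrite [q](@pihomog_partitionE _ _ mdeg _ _ (leqnn _)).
  rewrite mulr_suml linear_sum /=.
  elim/big_ind: _.
  - by exists 0; rewrite mul0r.
  - by move=> u v [a1 ->] [a2 ->]; exists (a1 + a2); rewrite mulrDl.
  move=> j _; have hj := dhomogM (pihomogP mdeg j q) hXe.
  have [<-|ne] := eqVneq (j + e)%N d.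
    by rewrite pihomog_dE //; exists (pihomog mdeg j q).
  by rewrite (pihomog_ne0 ne hj); exists 0; rewrite mul0r.
exists (fun y => U y /\ ~ y ('X_i ^+ e)); split=> //.
- exact: zariski_openI.
- by move=> y [].
exists 0, ('X_i ^+ e), (absz (e%:Z + m)), e; split=> //; first exact: dhomog0.
  by rewrite gez0_abs // /e abszE -lerBlDr sub0r -normrN ler_norm.
by move=> y [_ ?]; rewrite tofrac0 mul0r.
Qed.

Lemma twistD m U s t : twist_section m U s -> twist_section m U t ->
  twist_section m U (fun x => s x + t x).
Proof.
move=> hs ht x Ux.
have [V [oV Vx sVU [a [b [da [db [ha hb e h]]]]]]] := hs x Ux.
have [V' [oV' Vx' _ [a' [b' [da' [db' [ha' hb' e' h']]]]]]] := ht x Ux.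
exists (fun y => V y /\ V' y); split=> //; first exact: zariski_openI.
  by move=> y [/sVU].
exists (a * b' + a' * b), (b * b'), (da + db')%N, (db + db')%N; split.
- apply: rpredD; first exact: dhomogM.
  have -> : (da + db' = da' + db)%N.
    have : (da + db')%N%:Z = (da' + db)%N.
      by rewrite !PoszD e e' addrAC [RHS]addrAC (addrC db'%:Z).
    by case.
  exact: dhomogM.
- exact: dhomogM.
- by rewrite !PoszD e addrAC.
move=> y [/h [yb ->] /h' [yb' ->]]; split; first by case/pt_prime.
move/pt_neq0: yb; move/pt_neq0: yb'.
rewrite tofracD (tofracM a b') (tofracM a' b) (tofracM b b').
move: (a%:F) (b%:F) (a'%:F) (b'%:F) => u v u' v' v'0 v0.
exact: (addf_div u u' v0 v'0).
Qed.

Lemma twistM m m' U s t : twist_section m U s -> twist_section m' U t ->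
  twist_section (m + m') U (fun x => s x * t x).
Proof.
move=> hs ht x Ux.
have [V [oV Vx sVU [a [b [da [db [ha hb e h]]]]]]] := hs x Ux.
have [V' [oV' Vx' _ [a' [b' [da' [db' [ha' hb' e' h']]]]]]] := ht x Ux.
exists (fun y => V y /\ V' y); split=> //; first exact: zariski_openI.
  by move=> y [/sVU].
exists (a * a'), (b * b'), (da + da')%N, (db + db')%N.
split; try exact: dhomogM.
  by rewrite !PoszD e e' addrACA.
move=> y [/h [yb ->] /h' [yb' ->]]; split; first by case/pt_prime.
by rewrite !tofracM mulf_div.
Qed.

Lemma twist_poly m U (a : S) (da : nat) : zariski_open U ->
  a \is da.-homog -> da%:Z = m -> twist_section m U (fun=> a%:F).
Proof.
move=> oU ha e x Ux; exists U; split=> //.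
exists a, 1, da, 0%N; split=> //; [exact: dhomog1 | by rewrite e add0r |].
by move=> y Uy; split; [exact: pt_proper | rewrite tofrac1 divr1].
Qed.

(* The direct sum of the O(m_i), for m = (m_0, ..., m_(r-1)) *)
Section Twists.
Variables (r : nat) (m : r.-tuple int).

Definition twists_sec (U : Pn -> Prop) (s : Pn -> 'cV[K]_r) : Prop :=
  forall i : 'I_r, twist_section (tnth m i) U (fun x => s x i 0).

Fact twists_eq U s t : zariski_open U -> eq_on U s t -> twists_sec U s -> twists_sec U t.
Proof. by move=> _ e hs i; apply: twist_eq (hs i) => x /e ->. Qed.

Fact twists_res U V s : zariski_open U -> zariski_open V ->
  included V U -> twists_sec U s -> twists_sec V s.
Proof. by move=> _ oV sVU hs i; exact: twist_res (hs i). Qed.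

Fact twists_glue U s : zariski_open U ->
  (forall x, U x ->
     exists V, [/\ zariski_open V, V x, included V U & twists_sec V s]) ->
  twists_sec U s.
Proof.
move=> _ h i; apply: twist_glue => x /h [V [oV Vx sVU hs]].
by exists V; split.
Qed.

Fact twists0 U : zariski_open U -> twists_sec U (fun=> 0).
Proof.
move=> oU i; apply: twist_eq (twist0 (tnth m i) oU) => x _.
by rewrite mxE.
Qed.

Fact twists_lin U c s t : zariski_open U ->
  twist_section 0 U c -> twists_sec U s -> twists_sec U t ->
  twists_sec U (fun x => c x *: s x + t x).
Proof.
move=> oU hc hs ht i; have := twistM hc (hs i); rewrite add0r => hcs.
by apply: twist_eq (twistD hcs (ht i)) => x _; rewrite !mxE.
Qed.

Definition twists : omodule :=
  OModule twists_eq twists_res twists_glue twists0 twists_lin.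

End Twists.

Section Kernel.
Variables (F G : omodule) (phi : omorphism F G).

Definition oker_sec (U : Pn -> Prop) (s : Pn -> 'cV[K]_(orank F)) : Prop :=
  osec F U s /\ eq_on U (phi U s) (fun=> 0).

Fact oker_eq U s t : zariski_open U -> eq_on U s t -> oker_sec U s ->
  oker_sec U t.
Proof.
move=> oU e [hs h0]; have ht := osec_eq oU e hs; split=> // x Ux.
by rewrite -(omap_res phi oU oU (@included_refl U) hs ht e Ux) h0.
Qed.

Fact oker_res U V s : zariski_open U -> zariski_open V ->
  included V U -> oker_sec U s -> oker_sec V s.
Proof.
move=> oU oV sVU [hs h0]; have hsV := osec_res oU oV sVU hs.
split=> // x Vx; rewrite -(omap_res phi oU oV sVU hs hsV _ Vx) ?h0 //.
exact: sVU.
Qed.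

Fact oker_glue U s : zariski_open U ->
  (forall x, U x ->
     exists V, [/\ zariski_open V, V x, included V U & oker_sec V s]) ->
  oker_sec U s.
Proof.
move=> oU h; have hs : osec F U s.
  apply: osec_glue => // x /h [V [oV Vx sVU [hs _]]].
  by exists V.
split=> // x /h [V [oV Vx sVU [hsV h0]]].
by rewrite (omap_res phi oU oV sVU hs hsV _ Vx) ?h0.
Qed.

Fact oker0 U : zariski_open U -> oker_sec U (fun=> 0).
Proof.
move=> oU; have z := osec0 F oU; split=> // x Ux.
have h1 : twist_section 0 U (fun=> 1%:F).
  by apply: (twist_poly oU (dhomog1 k (mdeg (n := n.+1)))).
have hl := omap_lin phi oU h1 z z Ux.
have e : eq_on U (fun=> 1%:F *: 0 + 0 : 'cV[K]_(orank F)) (fun=> 0).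
  by move=> y _; rewrite scaler0 addr0.
have := omap_res phi oU oU (@included_refl U) (osec_lin oU h1 z z) z e Ux.
rewrite hl tofrac1 scale1r => /eqP.
by rewrite -subr_eq0 addrK => /eqP.
Qed.

Fact oker_lin U c s t : zariski_open U ->
  twist_section 0 U c -> oker_sec U s -> oker_sec U t ->
  oker_sec U (fun x => c x *: s x + t x).
Proof.
move=> oU hc [hs s0] [ht t0]; split; first exact: osec_lin.
move=> x Ux; rewrite (omap_lin phi oU hc hs ht Ux) s0 // t0 //.
by rewrite scaler0 addr0.
Qed.

Definition oker : omodule :=
  OModule oker_eq oker_res oker_glue oker0 oker_lin.

End Kernel.

Section Nabla.
Variables (r : nat) (sigma : r.-tuple {mpoly k[n.+1]}).
Hypothesis sigma_homog :
  forall i : 'I_r, tnth sigma i \is (mpdeg (tnth sigma i)).-homog.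

Definition nabla_source : omodule := twists [tuple 0 | j < n.+1].
Definition nabla_target : omodule :=
  twists [tuple (mpdeg (tnth sigma i))%:Z - 1 | i < r].

Definition nabla_map (U : Pn -> Prop) (s : Pn -> 'cV[K]_n.+1) : Pn -> 'cV[K]_r :=
  fun x => map_mx (@FracField.tofrac S) (jacobian sigma) *m s x.

Fact twist_mderiv U (f : S) (j : 'I_n.+1) : zariski_open U ->
  f \is (mpdeg f).-homog ->
  twist_section ((mpdeg f)%:Z - 1) U (fun=> (f^`M(j))%:F).
Proof.
move=> oU hf; case E: (mpdeg f) => [|d].
  have -> : f^`M(j) = 0.
    move: hf; rewrite E => /dhomogP hf.
    apply/mpolyP => m; rewrite mcoeff_mderiv mcoeff0.
    case: (boolP (m + U_(j) \in msupp f)%MM) => [/hf|/memN_msupp_eq0 ->].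
      by rewrite /= mdegD mdeg1 addn1.
    by rewrite mul0rn.
  by rewrite tofrac0; exact: twist0.
apply: (@twist_poly _ _ _ d) => //; last by rewrite -addn1 PoszD addrK.
move: hf; rewrite E => /dhomogP hf.
apply/dhomogP => m; rewrite mcoeff_msupp mcoeff_mderiv => h.
have /hf : (m + U_(j))%MM \in msupp f.
  by rewrite mcoeff_msupp; apply: contraNneq h => ->; rewrite mul0rn.
by rewrite /= mdegD mdeg1 addn1 => -[].
Qed.

Fact nabla_sec U s : zariski_open U -> osec nabla_source U s ->
  osec nabla_target U (nabla_map U s).
Proof.
move=> oU hs i; rewrite tnth_mktuple.
set m := _ - 1.
have h j : twist_section m U (fun x => ((tnth sigma i)^`M(j))%:F * s x j 0).
  have := twistM (twist_mderiv j oU (sigma_homog i)) (hs j).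
  by rewrite tnth_mktuple addr0.
suff: twist_section m U
    (fun x => \sum_(j < n.+1) ((tnth sigma i)^`M(j))%:F * s x j 0).
  apply: twist_eq => x _; rewrite /nabla_map mxE.
  by apply: eq_bigr => j _; rewrite !mxE.
elim: (index_enum _) => [|j js IH].
  by apply: twist_eq (twist0 m oU) => x _; rewrite big_nil.
by apply: twist_eq (twistD (h j) IH) => x _; rewrite big_cons.
Qed.

Fact nabla_res U V s t : zariski_open U -> zariski_open V -> included V U ->
  osec nabla_source U s -> osec nabla_source V t -> eq_on V s t ->
  eq_on V (nabla_map U s) (nabla_map V t).
Proof. by move=> _ _ _ _ _ e x Vx; rewrite /nabla_map e. Qed.

Fact nabla_lin U c s t : zariski_open U -> twist_section 0 U c ->
  osec nabla_source U s -> osec nabla_source U t ->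
  eq_on U (nabla_map U (fun x => c x *: s x + t x))
          (fun x => c x *: nabla_map U s x + nabla_map U t x).
Proof. by move=> _ _ _ _ x _; rewrite /nabla_map mulmxDr scalemxAr. Qed.

Definition nabla : omorphism nabla_source nabla_target :=
  OMorphism nabla_sec nabla_res nabla_lin.

Definition log_tangent_sheaf : omodule := oker nabla.

End Nabla.
End ProjectiveSpace.

Arguments osec [k n].
Arguments twists : clear implicits.
Arguments twists k n [r].

(* Main.v *)
(* In characteristic p dividing all the degrees, Euler's identity puts          *)
(* e = (x_0, ..., x_n) in the kernel of the Jacobian matrix J, whence the       *)
(* summand O(-1).  Let mu_ij be the signed minor of J deleting the columns i    *)
(* and j, and mu = g omega.  The kernel has rank 2, so e /\ v is proportional to *)
(* mu for every v in the kernel; as k[x_0, ..., x_n] is factorial and the       *)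
(* entries of omega have no common factor, e /\ v is a polynomial multiple of   *)
(* omega.  Moreover e /\ omega = 0, so that omega = e /\ w for some w by        *)
(* exactness of the Koszul complex of the variables; w is homogeneous of degree *)
(* d = deg mu - deg g - 1.  Then e /\ (v - h w) = 0 forces v - h w = c e, and   *)
(* the graded module ker J is free on e and w.                                  *)

From Stdlib Require Import Classical_Prop.
From mathcomp Require Import perm ring zify.
Require Import Defs.
Import GRing.Theory.
Local Open Scope ring_scope.

Set Implicit Arguments.
Unset Strict Implicit.
Unset Printing Implicit Defensive.

(** * Factoriality of polynomial rings *)

(** The proof finds a homogeneous basis of ker [J] over the polynomial ring and uses it as
    coordinates for local sections. Since the characteristic divides every degree, Euler's identity
    puts e = (x_0, ..., x_n) in ker [J] ([jacobian_euler]). For v in ker [J], the vector e /\ v is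
    proportional to the vector mu of signed maximal minors ([wedge_cominor]). Unique factorisation
    ([factorial_mpoly]) turns this into e /\ v = h omega, where mu = g omega ([kernel_wedge]). As e
    /\ omega = 0 ([cominor_koszul]), Koszul exactness ([koszul2]) gives omega = e /\ w. Here w can
    be taken homogeneous, of degree one less than omega, and it lies in ker [J] ([kernel_of_wedge]).
    Now e /\ (v - h w) = 0, so v - h w is a multiple of e by [koszul1]; hence [kernel_basis].

    A section of the kernel sheaf is locally A / b with A in ker [J] and A, b homogeneous of equal
    degree ([common_denominator]). Cramer's rule shows that the coordinates of A on e and w are
    homogeneous, so those of the section have degrees -1 and -d ([kernel_section_coords]). Taking
    coordinates and forming combinations of e and w are then inverse morphisms
    ([log_tangent_sheaf_split]). *)

Section Factorial.
Variable D : idomainType.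
Implicit Types a b c : D.

Lemma divides_refl a : divides a a.
Proof. by exists 1; rewrite mul1r. Qed.

Lemma divides_mull a b c : divides a b -> divides a (c * b).
Proof. by case=> q ->; exists (c * q); rewrite mulrA. Qed.

Lemma divides_mulr a b c : divides a b -> divides a (b * c).
Proof. by rewrite mulrC; exact: divides_mull. Qed.

Lemma divides_trans a b c : divides a b -> divides b c -> divides a c.
Proof. by move=> ab [q ->]; exact: divides_mull. Qed.

Lemma dividesD a b c : divides a b -> divides a c -> divides a (b + c).
Proof. by case=> q -> [r ->]; exists (q + r); rewrite mulrDl. Qed.

Lemma divides_sum (I : Type) (s : seq I) (P : pred I) (F : I -> D) a :
  (forall i, P i -> divides a (F i)) -> divides a (\sum_(i <- s | P i) F i).
Proof.
move=> aF; elim/big_rec: _ => [|i b Pi ab]; first by exists 0; rewrite mul0r.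
by apply: dividesD => //; exact: aF.
Qed.

Definition prime_elt a : Prop :=
  [/\ a != 0, a \isn't a GRing.unit
    & forall b c, divides a (b * c) -> divides a b \/ divides a c].

Lemma prime_elt_ndivides_unit a b :
  prime_elt a -> b \is a GRing.unit -> ~ divides a b.
Proof.
by case=> _ /negP ua _ ub [q eb]; apply: ua; move: ub; rewrite eb unitrM => /andP[].
Qed.

Lemma prime_elt_dividesC a b : prime_elt a -> prime_elt b -> divides a b ->
  divides b a.
Proof.
move=> [_ /negP ua _] [b0 _ pb] [q eb].
have := pb q a; rewrite -eb => /(_ (divides_refl b)) [[r er]|//].
case: ua; apply/unitrP; exists r; suff: r * a = 1 by split=> //; rewrite mulrC.
by apply: (mulfI b0); rewrite mulr1 {2}eb er mulrCA mulrA.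
Qed.

Inductive prime_factored : D -> Prop :=
| prime_factored_unit a : a \is a GRing.unit -> prime_factored a
| prime_factored_mul a b :
    prime_elt a -> prime_factored b -> prime_factored (a * b).

(** Existence of factorisations into prime, not merely irreducible, elements: uniqueness is then
    automatic. *)
Definition factorial_domain : Prop := forall a, a != 0 -> prime_factored a.

Lemma prime_factoredM a b :
  prime_factored a -> prime_factored b -> prime_factored (a * b).
Proof.
move=> fa fb; elim: fa => [u uu|p c pp _ IH]; last first.
  by rewrite -mulrA; exact: prime_factored_mul.
case: fb => [v uv|p c pp fc].
  by apply: prime_factored_unit; rewrite unitrM uu.
suff: prime_factored (u * c) by rewrite mulrCA; exact: prime_factored_mul.
elim: fc => [v uv|q d pq _ IH]; first by apply: prime_factored_unit; rewrite unitrM uu.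
by rewrite mulrCA; exact: prime_factored_mul.
Qed.

(** The primes of [t] are stripped off one at a time: a prime not dividing [a] would divide every
    [b i], hence be a unit. *)
Lemma prime_factored_gauss (I : Type) (b : I -> D) t a :
  prime_factored t ->
  (forall c, (forall i, divides c (b i)) -> c \is a GRing.unit) ->
  (forall i, divides t (a * b i)) -> divides t a.
Proof.
move=> ft cb; elim: ft a => [u uu a _|p s pp _ IH a h].
  by exists (a / u); rewrite mulrVK.
have [p0 /negP pu pM] := pp.
have [a1 ea] : divides p a.
  apply: NNPP => npa; apply: pu; apply: cb => i.
  have /pM [//|//] : divides p (a * b i).
  by apply: divides_trans (h i); exists s; rewrite mulrC.
have [|q eq] := IH a1; last by exists q; rewrite ea eq -mulrA (mulrC s).
move=> i; have [q eq] := h i; exists q; apply: (mulfI p0).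
by rewrite mulrA (mulrC p) -ea eq mulrCA.
Qed.

End Factorial.

(** * Gauss's lemma and factoriality of polynomials in one variable *)

Section PolyFactorial.
Variable D : idomainType.
Implicit Types (a b d : D) (f g h : {poly D}).

(** If [a] divides [f * g], it divides the product of the leading coefficients, hence one of them;
    removing that leading term preserves the divisibility and lowers the total size. *)
Lemma prime_eltC a : prime_elt a -> prime_elt a%:P.
Proof.
move=> [a0 ua pa]; split; first by rewrite polyC_eq0.
  by rewrite poly_unitE size_polyC a0 coefC eqxx.
have lead f g : divides a%:P (f * g) ->
    divides a (lead_coef f) \/ divides a (lead_coef g).
  case=> q e; apply: pa; rewrite -lead_coefM e lead_coefM lead_coefC.
  by exists (lead_coef q).
have drop f : divides a (lead_coef f) -> f != 0 -> exists f1 q,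
    f = f1 + q * a%:P /\ (size f1 < size f)%N.
  move=> [c ec] f0; exists (f - (lead_coef f)%:P * 'X^((size f).-1)).
  exists (c%:P * 'X^((size f).-1)); split.
    by rewrite ec polyCM mulrAC subrK.
  rewrite -(prednK (n := size f)) ?size_poly_gt0 // ltnS.
  apply/leq_sizeP => j lej; rewrite coefB coefCM coefXn.
  case: eqP => [->|/eqP ne]; first by rewrite mulr1 lead_coefE subrr.
  rewrite mulr0 subr0 nth_default //.
  by rewrite -(prednK (n := size f)) ?size_poly_gt0 // ltn_neqAle eq_sym ne.
move=> f g; have [n] := ubnP (size f + size g).
elim: n f g => // n IH f g; rewrite ltnS => len fg.
have [->|f0] := eqVneq f 0; first by left; exists 0; rewrite mul0r.
have [->|g0] := eqVneq g 0; first by right; exists 0; rewrite mul0r.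
have [/drop /(_ f0) [f1 [q [ef lt]]]|/drop /(_ g0) [g1 [q [eg lt]]]] := lead _ _ fg.
- have [||[r er]|] := IH f1 g; last by right.
  + by apply: leq_trans len; rewrite ltn_add2r.
  + have [s es] := fg; exists (s - q * g).
    by rewrite mulrBl -es ef mulrDl mulrAC addrK.
  by left; exists (r + q); rewrite ef er mulrDl.
- have [||hf|[r er]] := IH f g1.
  + by apply: leq_trans len; rewrite ltn_add2l.
  + have [s es] := fg; exists (s - f * q).
    by rewrite mulrBl -es eg mulrDr mulrA addrK.
  + by left.
  by right; exists (r + q); rewrite eg er mulrDl.
Qed.

Lemma divides_polyC_lead_coef a f : divides a%:P f -> divides a (lead_coef f).
Proof. by case=> q ->; exists (lead_coef q); rewrite lead_coefM lead_coefC. Qed.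

Lemma prime_factoredC a : prime_factored a -> prime_factored a%:P.
Proof.
elim=> [u uu|p c pp _ IH].
  have u0 : u != 0 by apply: contraTneq uu => ->; rewrite unitr0.
  by apply: prime_factored_unit; rewrite poly_unitE size_polyC u0 coefC eqxx.
by rewrite polyCM; apply: prime_factored_mul => //; exact: prime_eltC.
Qed.

(* Clearing denominators in a factorisation over the fraction field *)
Lemma poly_factor_cancel d f g h : prime_factored d -> d%:P * f = g * h ->
  exists g1 h1, [/\ f = g1 * h1, size g1 = size g & size h1 = size h].
Proof.
move=> fd; elim: fd g h => [u uu|p c pp _ IH] g h e.
  exists ((u^-1)%:P * g), h; split=> //.
    by rewrite -mulrA -e mulrA -polyCM mulVr // mul1r.
  by rewrite mul_polyC size_scale // invr_eq0; apply: contraTneq uu => ->; rewrite unitr0.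
have [p0 _ _] := pp; have pC0 : p%:P != 0 by rewrite polyC_eq0.
have [_ _ /(_ g h) []] := prime_eltC pp.
- by exists (c%:P * f); rewrite -e polyCM -mulrA mulrC.
- move=> [q eq]; have [|g1 [h1 [ef sg sh]]] := IH q h.
    by apply: (mulfI pC0); rewrite mulrA -polyCM e eq mulrAC mulrC.
  by exists g1, h1; rewrite eq (mulrC q) mul_polyC size_scale.
move=> [q eq]; have [|g1 [h1 [ef sg sh]]] := IH g q.
  by apply: (mulfI pC0); rewrite mulrA -polyCM e eq mulrA mulrC.
by exists g1, h1; rewrite eq (mulrC q) mul_polyC size_scale.
Qed.

(** Each prime of [d] stays prime in [{poly D}] and does not divide the primitive [f], so it divides
    [q] and cancels. *)
Lemma poly_primitive_cancel d f g q : (forall a, prime_elt a -> ~ divides a%:P f) ->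
  prime_factored d -> d%:P * g = q * f -> divides f g.
Proof.
move=> prim fd; elim: fd q => [u uu|p c pp _ IH] q e.
  by exists ((u^-1)%:P * q); rewrite -mulrA -e mulrA -polyCM mulVr // mul1r.
have [p0 _ _] := pp; have pC0 : p%:P != 0 by rewrite polyC_eq0.
have [_ _ /(_ q f) []] := prime_eltC pp.
- by exists (c%:P * g); rewrite -e polyCM -mulrA mulrC.
- move=> [r er]; apply: (IH r); apply: (mulfI pC0).
  by rewrite mulrA -polyCM e er mulrAC mulrC.
by move/prim; case.
Qed.

Import Pdiv.CommonIdomain Pdiv.IdomainDefs.

(** Over a domain, [%|] is divisibility up to a nonzero constant, so [irreducible_poly] means
    irreducible over the fraction field, where Euclid's lemma holds; primitivity brings the
    divisibility back to [D]. *)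
Lemma irredp_primitive_prime f : factorial_domain D -> irreducible_poly f ->
  (forall a, prime_elt a -> ~ divides a%:P f) -> prime_elt f.
Proof.
move=> fD irr prim; have [sf irrf] := irr; split.
- exact: irredp_neq0.
- by rewrite poly_unitE; case: eqP sf => // ->.
have down g : f %| g -> divides f g.
  case/Pdiv.WeakIdomain.dvdpP=> -[c q] /= /fD fc e.
  by apply: (poly_primitive_cancel prim fc (q := q)); rewrite mul_polyC.
move=> g h [q e]; have fgh : f %| g * h by rewrite e dvdp_mull.
have [cop|ncop] := boolP (coprimep f g).
  by right; apply: down; rewrite -(Gauss_dvdpr _ cop).
left; apply: down; have := irrf _ ncop (dvdp_gcdl f g).
by move/eqp_dvdl <-; exact: dvdp_gcdr.
Qed.

(* The second factor [e] of the leading coefficient collects the primes     *)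
(* already known not to divide [f].                                         *)
Lemma irredp_factored d f e : factorial_domain D -> prime_factored d ->
  irreducible_poly f -> lead_coef f = d * e ->
  (forall a, prime_elt a -> divides a e -> ~ divides a%:P f) ->
  prime_factored f.
Proof.
move=> fD fd; elim: fd f e => [u uu|p c pp _ IH] f e irr lf ne.
  rewrite -[f]mulr1; apply: prime_factored_mul; last first.
    exact/prime_factored_unit/unitr1.
  apply: irredp_primitive_prime => // a pa af; apply: (ne _ pa) => //.
  have := divides_polyC_lead_coef af; rewrite lf.
  by case: (pa) => _ _ /[apply] -[/(prime_elt_ndivides_unit pa uu)|].
have [p0 _ _] := pp; have pC0 : p%:P != 0 by rewrite polyC_eq0.
have [[f1 ef]|npf] := classic (divides p%:P f).
  rewrite ef mulrC; apply: prime_factored_mul; first exact: prime_eltC.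
  have ff1 : f %= f1 by rewrite ef mulrC mul_polyC eqp_scale.
  apply: (IH _ e).
  - have [sf irrf] := irr; split; first by rewrite -(eqp_size ff1).
    by move=> q sq qf1; rewrite -(eqp_rtrans ff1); apply: irrf; rewrite ?(eqp_dvdr _ ff1).
  - apply: (mulfI p0); rewrite mulrA -lf ef lead_coefM lead_coefC mulrC //.
  by move=> a pa /(ne _ pa) af af1; apply: af; rewrite ef; exact: divides_mulr.
apply: (IH f (p * e)) => //; first by rewrite lf mulrCA mulrA.
move=> a pa; have [_ _ /(_ p e) h] := pa => /h [ap|/(ne _ pa) //] af; apply: npf.
apply: divides_trans af; have [q ->] := prime_elt_dividesC pa pp ap.
by exists q%:P; rewrite polyCM.
Qed.

(** By induction on the size: a nonconstant polynomial that is reducible over the fraction field has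
    a proper factor there, and [poly_factor_cancel] converts this into a factorisation over [D] with
    the same degrees. *)
Lemma factorial_poly : factorial_domain D -> factorial_domain {poly D}.
Proof.
move=> fD f; have [n] := ubnP (size f).
elim: n f => // n IH f; rewrite ltnS => lef f0.
have [irr|nirr] := classic (irreducible_poly f).
  have lf : lead_coef f != 0 by rewrite lead_coef_eq0.
  apply: (irredp_factored (e := 1) fD (fD _ lf) irr); first by rewrite mulr1.
  by move=> a pa /(prime_elt_ndivides_unit pa (unitr1 _)).
have [sf|sf] := leqP (size f) 1.
  rewrite (size1_polyC sf); apply: prime_factoredC; apply: fD.
  by apply: contraNneq f0 => e; rewrite (size1_polyC sf) e.
have [q [sq qf nqf]] : exists q : {poly D}, [/\ size q != 1%N, q %| f & ~ q %= f].
  apply: NNPP => nex; apply: nirr; split=> // q sq qf; apply: NNPP => nqf.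
  by apply: nex; exists q.
have ltq : (size q < size f)%N.
  by rewrite ltn_neqAle (dvdp_leq f0 qf) (dvdp_size_eqp qf) andbT; apply/negP.
have [[c r] /= c0 e] := Pdiv.WeakIdomain.dvdpP _ _ qf.
have [|g1 [h1 [ef sg sh]]] := poly_factor_cancel (fD c c0) (f := f) (g := r) (h := q).
  by rewrite mul_polyC.
have := f0; rewrite ef mulf_eq0 negb_or => /andP[g10 h10].
apply: prime_factoredM; apply: IH => //; apply: leq_trans lef; last by rewrite sh.
have lth : (1 < size h1)%N.
  by rewrite ltn_neqAle eq_sym {1}sh sq size_poly_gt0.
rewrite ef size_mul //; case: (size h1) lth => // b lth.
by rewrite addnS -{1}[size g1]addn0 ltn_add2l.
Qed.

End PolyFactorial.

Lemma prime_factored_bij (A B : idomainType) (f : {rmorphism A -> B}) :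
  injective f -> (forall b, exists a, b = f a) ->
  forall a, prime_factored (f a) -> prime_factored a.
Proof.
move=> inj surj.
have divE a b : divides (f a) (f b) <-> divides a b.
  split=> [[q]|[q ->]]; last by exists (f q); rewrite rmorphM.
  by have [c ->] := surj q; rewrite -rmorphM => /inj ->; exists c.
have unitE a : f a \is a GRing.unit -> a \is a GRing.unit.
  move=> ua; have [b eb] := surj (f a)^-1; apply/unitrP; exists b.
  have e : b * a = 1 by apply: inj; rewrite rmorphM rmorph1 -eb mulVr.
  by split=> //; rewrite mulrC.
suff H b : prime_factored b -> forall a, f a = b -> prime_factored a.
  by move=> a /H; apply.
elim=> [u uu a e|p c pp fc IH a e].
  by apply: prime_factored_unit; apply: unitE; rewrite e.
have [p1 ep] := surj p; have [c1 ec] := surj c.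
have -> : a = p1 * c1 by apply: inj; rewrite e ep ec rmorphM.
apply: prime_factored_mul; last by apply: IH.
have [p0 up pM] := pp; split.
- by apply: contra_neq p0 => p10; rewrite ep p10 rmorph0.
- by apply: contra up => u1; rewrite ep rmorph_unit.
by move=> x y /divE; rewrite rmorphM -ep => /pM [] h; [left|right]; apply/divE; rewrite -ep.
Qed.

(** * Polynomials in several variables over a field *)

Section MPolyFactorial.
Variables (k : fieldType).

Lemma muniX n (m : 'X_{1..n.+1}) : muni 'X_[m] =
  'X_[k, [multinom m (widen_ord (leqnSn n) i) | i < n]] *: 'X^(m ord_max).
Proof. by rewrite muniE msuppX big_seq1 mcoeffX eqxx scale1r. Qed.

Lemma muni_mwiden n (p : {mpoly k[n]}) : muni (mwiden p) = p%:P.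
Proof.
rewrite {1}[p]mpolyE (raddf_sum (@mwiden n k)) [in RHS](mpolyE p).
rewrite (raddf_sum (@muni n k)) raddf_sum.
apply: eq_bigr => m _ /=; rewrite mwidenZ muniZ mwidenX muniX mnmwiden_ordmax.
rewrite expr0 -!mul_polyC mulr1 -polyCM mul_mpolyC; congr (_ *: 'X_[_])%:P.
by apply/mnmP => i; rewrite mnmE mnmwiden_widen.
Qed.

(** The inverse of [muni] widens the coefficients and substitutes the last variable; [muni_inj] uses
    the same map. *)
Lemma muni_surj n (q : {poly {mpoly k[n]}}) : exists p, q = muni p.
Proof.
exists (mpwiden q).['X_ord_max]; elim/poly_ind: q => [|q c IH].
  by rewrite (raddf0 (@mpwiden n k)) horner0 muni0.
rewrite (raddfD (@mpwiden n k)) /= (rmorphM (@mpwiden n k)) /= mpwidenX mpwidenC.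
rewrite !hornerE /= muniD muniM -IH.
rewrite muni_mwiden muniX mnm1E eqxx expr1 -mul_polyC.
set m := [multinom _ | _ < _]; suff -> : m = 0%MM by rewrite mpolyX0 mul1r.
apply/mnmP => i; rewrite mnmE mnm1E mnm0E -val_eqE /=.
by rewrite gtn_eqF ?ltn_ord.
Qed.

Lemma muni_inj n : injective (@muni n k).
Proof.
suff K : cancel (@muni n k) (fun q => (mpwiden q).['X_ord_max]).
  exact: can_inj K.
move=> p; rewrite {1}[p]mpolyE (raddf_sum (@muni n k)).
rewrite (raddf_sum (@mpwiden n k)) horner_sum [RHS]mpolyE /=.
apply: eq_bigr => m _; rewrite muniZ mpwidenZ hornerZ mwidenC mul_mpolyC.
congr (_ *: _); rewrite muniX mpwidenZ hornerZ mwidenX.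
rewrite /mpwiden map_polyXn hornerXn mpolyXn -mpolyXD; congr 'X_[_].
apply/mnmP => i; rewrite mnmDE mulmnE mnm1E.
have [<-|ne] := eqVneq ord_max i.
  by rewrite mnmwiden_ordmax mul1n.
have lti : (i < n)%N.
  by rewrite ltn_neqAle -ltnS ltn_ord andbT eq_sym -(inj_eq val_inj) in ne *.
have -> : i = widen_ord (leqnSn n) (Ordinal lti) by apply: val_inj.
by rewrite mnmwiden_widen mnmE mul0n addn0.
Qed.

Lemma factorial_mpoly n : factorial_domain {mpoly k[n]}.
Proof.
elim: n => [|n IH] p p0.
  apply: prime_factored_unit; rewrite (nvar0_mpolyC p) in p0 *.
  by rewrite mpolyC_eq0 in p0; apply: rmorph_unit; rewrite unitfE.
apply: (prime_factored_bij (@muni_inj n) (@muni_surj n)).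
by apply: factorial_poly => //; apply: contra_neq p0 => e; apply: muni_inj; rewrite e muni0.
Qed.

End MPolyFactorial.

(** * Homogeneous polynomials and the Koszul complex *)

Section Homogeneity.
Variables (R : idomainType) (n : nat).
Implicit Types (a b : {mpoly R[n]}).

Lemma mcoeff_msupp_filter (P : pred 'X_{1..n}) a m :
  (\sum_(m' <- msupp a | P m') a@_m' *: 'X_[m'])@_m = if P m then a@_m else 0.
Proof.
rewrite raddf_sum /= [in RHS](mpolyE a) raddf_sum /= big_mkcond /=.
case: ifP => Pm; last first.
  apply: big1 => m' _; case: ifP => // Pm'; rewrite mcoeffZ mcoeffX.
  by case: eqP Pm' => [->|]; rewrite ?Pm ?mulr0.
apply: eq_bigr => m' _; rewrite mcoeffZ mcoeffX.
by case: (eqVneq m' m) => [->|]; rewrite ?Pm // mulr0 if_same.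
Qed.

Lemma mcoeff_pihomog d a m :
  (pihomog mdeg d a)@_m = if mdeg m == d then a@_m else 0.
Proof. by rewrite pihomogE mcoeff_msupp_filter. Qed.

Lemma mdeg_mlead_ge a m : m \in msupp a -> (mdeg m <= mdeg (mlead a))%N.
Proof.
move=> ma; rewrite -ltnS mlead_deg; first exact: msize_mdeg_lt.
by apply: contraTneq ma => ->; rewrite msupp0.
Qed.

Lemma low_degree a : a != 0 -> exists l,
  [/\ pihomog mdeg l a != 0, forall m, m \in msupp a -> (l <= mdeg m)%N
    & forall m, m \in msupp (a - pihomog mdeg l a) -> (l < mdeg m)%N].
Proof.
move=> a0.
have ex : exists d, has (fun m => mdeg m == d) (msupp a).
  by exists (mdeg (mlead a)); apply/hasP; exists (mlead a); rewrite ?mlead_supp.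
case: (ex_minnP ex) => l /hasP [m0 m0a /eqP dm0] lmin; exists l.
have le m : m \in msupp a -> (l <= mdeg m)%N.
  by move=> ma; apply: lmin; apply/hasP; exists m.
split=> //.
  apply/eqP => /(congr1 (mcoeff m0)); rewrite mcoeff_pihomog dm0 eqxx mcoeff0.
  by apply/eqP; rewrite -mcoeff_msupp.
move=> m; rewrite mcoeff_msupp mcoeffB mcoeff_pihomog.
case: (mdeg m =P l) => [_|/eqP ne]; first by rewrite subrr eqxx.
by rewrite subr0 -mcoeff_msupp => /le; rewrite leq_eqVlt eq_sym (negPf ne).
Qed.

(** The lowest components of [a] and [b] have nonzero product, so their degrees add up to [D]; so do
    the degrees of the leading monomials. In each factor the extreme degrees therefore coincide. *)
Lemma dhomog_factorl D a b : a * b != 0 -> a * b \is D.-homog ->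
  exists da db, [/\ a \is da.-homog, b \is db.-homog & (da + db = D)%N].
Proof.
move=> ab0 hab; have := ab0; rewrite mulf_eq0 negb_or => /andP[a0 b0].
have [la [al0 lea lta]] := low_degree a0.
have [lb [bl0 leb ltb]] := low_degree b0.
(* Products involving a term above the lowest component contribute nothing in the lowest degree. *)
have hi (x y : {mpoly R[n]}) dx dy : (forall m, m \in msupp x -> (dx < mdeg m)%N) ->
    (forall m, m \in msupp y -> (dy <= mdeg m)%N) ->
    pihomog mdeg (dx + dy) (x * y) = 0.
  move=> hx hy; apply/mpolyP => m; rewrite mcoeff_pihomog mcoeff0.
  case: eqP => // e; apply/eqP; apply: contraTT isT; rewrite -mcoeff_msupp.
  move=> /msuppM_le /allpairsP [[m1 m2] /= [/hx h1 /hy h2 em]].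
  by move: e; rewrite em mdegD => e; have := leq_add h1 h2; rewrite addSn e ltnn.
have eD : (la + lb = D)%N.
  apply/eqP; apply: contraTT isT => ne.
  have := pihomog_ne0 (b := (la + lb)%N) _ hab; rewrite eq_sym => /(_ ne).
  have -> : a * b = pihomog mdeg la a * pihomog mdeg lb b
      + ((a - pihomog mdeg la a) * b
      + (b - pihomog mdeg lb b) * pihomog mdeg la a) by ring.
  have z1 : pihomog mdeg (la + lb) ((a - pihomog mdeg la a) * b) = 0 by apply: hi.
  have z2 : pihomog mdeg (lb + la) ((b - pihomog mdeg lb b) * pihomog mdeg la a) = 0.
    by apply: hi => // m /(dhomogP _ _ _ (pihomogP _ _ _)) ->.
  rewrite !pihomogD z1 (addnC la) z2 !addr0 addnC.
  rewrite pihomog_dE ?(dhomogM (pihomogP _ _ _) (pihomogP _ _ _)) // => /eqP.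
  by rewrite mulf_eq0 (negPf al0) (negPf bl0).
have top : (mdeg (mlead a) + mdeg (mlead b) = D)%N.
  by rewrite -mdegD -mleadM //; apply: (dhomogP _ _ _ hab); exact: mlead_supp.
have lead_a := lea _ (mlead_supp a0); have lead_b := leb _ (mlead_supp b0).
have ta : mdeg (mlead a) = la.
  apply/eqP; rewrite eqn_leq lead_a andbT -(leq_add2r lb) eD -top.
  by rewrite leq_add2l.
have tb : mdeg (mlead b) = lb by apply/eqP; rewrite -(eqn_add2l la) eD -{1}ta top.
exists la, lb; split=> //; apply/dhomogP => m ms; apply/eqP; rewrite eqn_leq.
  by rewrite lea // -ta mdeg_mlead_ge.
by rewrite leb // -tb mdeg_mlead_ge.
Qed.

End Homogeneity.


(** * The variables as a regular sequence *)

Section Variables.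
Variables (R : idomainType) (n : nat).
Implicit Types (a b c : {mpoly R[n]}) (i j l : 'I_n).

Lemma mcoeff_varM_eq0 i a (m : 'X_{1..n}) : m i = 0%N -> ('X_i * a)@_m = 0.
Proof.
move=> mi; apply/eqP; apply: contraTT isT; rewrite -mcoeff_msupp.
move=> /msuppM_le /allpairsP [[m1 m2] /= []]; rewrite msuppX inE => /eqP -> _ em.
by move: mi; rewrite em mnmDE mnm1E eqxx.
Qed.

Lemma divides_var i a : (forall m : 'X_{1..n}, m i = 0%N -> a@_m = 0) -> divides 'X_i a.
Proof.
move=> h; rewrite [a]mpolyE; apply: divides_sum => m _.
have [/h ->|mi] := eqVneq (m i) 0%N; first by exists 0; rewrite scale0r mul0r.
exists (a@_m *: 'X_[m - U_(i)]); rewrite -scalerAl -mpolyXD submK //.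
apply/mnm_lepP => j; rewrite mnm1E; case: eqP => // <-.
by rewrite lt0n.
Qed.

Lemma divides_varM_var i j a : i != j ->
  divides 'X_i ('X_j * a) -> divides 'X_i a.
Proof.
move=> ne [q e]; apply: divides_var => m mi.
rewrite -(mcoeffMX a U_(j)) mulrC e mulrC mcoeff_varM_eq0 //.
by rewrite mnmDE mnm1E mi eq_sym (negPf ne).
Qed.

(** ['X_l] is a nonzerodivisor modulo the ideal of ['X_i] and ['X_j]: multiplying by it keeps the
    exponents at [i] and [j], so [a] has no monomial free of both variables. *)
Lemma regular_var3 i j l a b c : i != l -> j != l ->
  'X_l * a = 'X_i * b + 'X_j * c -> exists u v, a = 'X_i * u + 'X_j * v.
Proof.
move=> il jl e.
pose a1 := \sum_(m <- msupp a | m i == 0%N) a@_m *: 'X_[m].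
have a1E m : a1@_m = if m i == 0%N then a@_m else 0 by exact: mcoeff_msupp_filter.
have [u eu] : divides 'X_i (a - a1).
  by apply: divides_var => m mi; rewrite mcoeffB a1E mi subrr.
have [v ev] : divides 'X_j a1.
  apply: divides_var => m mj; rewrite a1E; case: eqP => // mi.
  rewrite -(mcoeffMX a U_(l)) mulrC e mcoeffD !mcoeff_varM_eq0 ?addr0 //.
    by rewrite mnmDE mnm1E mj eq_sym (negPf jl).
  by rewrite mnmDE mnm1E mi eq_sym (negPf il).
by exists u, v; rewrite mulrC -eu mulrC -ev subrK.
Qed.

End Variables.

(* Exactness of the Koszul complex of the variables in degrees 1 and 2 *)
Section Koszul.
Variables (R : idomainType) (n : nat).
Hypothesis n_gt2 : (2 < n)%N.
Notation S := {mpoly R[n]}.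

Lemma koszul1 (v : 'I_n -> S) :
  (forall i j, 'X_i * v j = 'X_j * v i) -> exists c, forall i, v i = c * 'X_i.
Proof.
move=> h; pose i0 := Ordinal (ltnW (ltnW n_gt2)); pose i1 := Ordinal (ltnW n_gt2).
have [c ec] : divides 'X_i0 (v i0).
  by apply: (@divides_varM_var _ _ i0 i1) => //; rewrite h; exists (v i1); rewrite mulrC.
have X0 : 'X_i0 != 0 :> S by rewrite -msupp_eq0 msuppX.
exists c => i; apply: (mulfI X0).
by rewrite h ec; ring.
Qed.

Lemma koszul2 (w : 'I_n -> 'I_n -> S) :
  (forall i j l, 'X_i * w j l - 'X_j * w i l + 'X_l * w i j = 0) ->
  exists v : 'I_n -> S, forall i j, w i j = 'X_i * v j - 'X_j * v i.
Proof.
move=> h; pose i0 := Ordinal (ltnW (ltnW n_gt2)); pose i1 := Ordinal (ltnW n_gt2).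
pose i2 := Ordinal n_gt2.
have X0 : 'X_i0 != 0 :> S by rewrite -msupp_eq0 msuppX.
have [u [v e01]] : exists u v, w i0 i1 = 'X_i0 * u + 'X_i1 * v.
  apply: (@regular_var3 _ _ i0 i1 i2 _ (- w i1 i2) (w i0 i2)) => //.
  by apply/eqP; rewrite -subr_eq0; apply/eqP; rewrite -[RHS](h i0 i1 i2); ring.
(* The preimage is read off the row [i0], [- v] serving as its component at [i0]; the quotients by
   ['X_i0] are the components sought. *)
have dv j : divides 'X_i0 (w i0 j - 'X_j * v).
  apply: (@divides_varM_var _ _ i0 i1) => //.
  have := h i0 i1 j; rewrite e01 => e; exists (w i1 j + 'X_j * u).
  by apply/eqP; rewrite -subr_eq0 -oppr_eq0; apply/eqP; rewrite -[RHS]e; ring.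
have [q eq] := fin_all_exists dv; exists q => i j; apply: (mulfI X0).
have := h i0 i j; have ei := eq i; have ej := eq j.
move/eqP: ei; move/eqP: ej; rewrite !subr_eq => /eqP -> /eqP -> e.
by apply/eqP; rewrite -subr_eq0; apply/eqP; rewrite -[RHS]e; ring.
Qed.

End Koszul.

(** * Euler's identity and the degrees of derivatives *)

Section Derivatives.
Variables (R : idomainType) (n : nat).
Implicit Types (f : {mpoly R[n]}).

Lemma euler d f : f \is d.-homog -> \sum_j f^`M(j) * 'X_j = f *+ d.
Proof.
move=> /dhomogP hf; rewrite [in RHS](mpolyE f) -sumrMnl.
transitivity (\sum_(m <- msupp f) \sum_(j < n) (f@_m *: 'X_[m])^`M(j) * 'X_j).
  rewrite exchange_big; apply: eq_bigr => j _.
  by rewrite {1}(mpolyE f) raddf_sum mulr_suml.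
apply: eq_big_seq => m /hf /= <-; rewrite mdegE -sumrMnr; apply: eq_bigr => j _.
rewrite mderivZ mderivX -!scalerAl -mpolyXD scalerA -scaler_nat scalerA mulrC.
have [->|mj] := eqVneq (m j) 0%N; first by rewrite mul0r !scale0r.
rewrite submK //; apply/mnm_lepP => i; rewrite mnm1E; case: eqP => // <-.
by rewrite lt0n.
Qed.

Lemma dhomog_mderiv0 f j : f \is 0.-homog -> f^`M(j) = 0.
Proof.
move=> /dhomogP hf; apply/mpolyP => m; rewrite mcoeff_mderiv mcoeff0.
case: (boolP (m + U_(j) \in msupp f)%MM) => [/hf|/memN_msupp_eq0 ->].
  by rewrite /= mdegD mdeg1 addn1.
by rewrite mul0rn.
Qed.

Lemma dhomog_mderiv d f j : f \is d.-homog -> f^`M(j) \is d.-1.-homog.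
Proof.
case: d => [|d] hf; first by rewrite dhomog_mderiv0 ?rpred0.
move/dhomogP: hf => hf; apply/dhomogP => m; rewrite mcoeff_msupp mcoeff_mderiv => h.
have /hf : (m + U_(j))%MM \in msupp f.
  by rewrite mcoeff_msupp; apply: contraNneq h => ->; rewrite mul0rn.
by rewrite /= mdegD mdeg1 addn1 => -[].
Qed.

End Derivatives.

(** * Minors and the kernel of a matrix of corank two *)

Lemma det2 (R : comRingType) (A : 'M[R]_2) :
  \det A = A 0 0 * A 1 1 - A 0 1 * A 1 0.
Proof.
rewrite (expand_det_row A 0) !big_ord_recl big_ord0 addr0 /cofactor !det_mx11 !mxE.
rewrite /= !expr0 !expr1 mul1r mulN1r mulrN.
by congr (_ * A _ _ - A _ _ * A _ _); apply: val_inj.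
Qed.

Lemma row_mx2E0 (R : Type) m (v w : 'cV[R]_m) i :
  (row_mx v w : 'M_(m, 1 + 1)) i 0 = v i 0.
Proof. by rewrite -(row_mxEl v w); congr (row_mx v w _ _); apply: val_inj. Qed.

Lemma row_mx2E1 (R : Type) m (v w : 'cV[R]_m) i :
  (row_mx v w : 'M_(m, 1 + 1)) i 1 = w i 0.
Proof. by rewrite -(row_mxEr v w); congr (row_mx v w _ _); apply: val_inj. Qed.

Definition pair_sel (T : Type) (i j : T) (a : 'I_2) : T := if a == 0 then i else j.

Definition wedge (R : pzRingType) m (v w : 'cV[R]_m) (i j : 'I_m) : R :=
  v i 0 * w j 0 - v j 0 * w i 0.

Section Minors.
Variables (D : idomainType) (r : nat).
Variable J : 'M[D]_(r, 2 + r).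
Notation c := (2 + r).

(** Two unit rows on top of [J] let the determinant carry the signs of the minors and make them
    alternating in [i] and [j]. *)
Definition bordered (i j : 'I_c) : 'M[D]_c :=
  col_mx (rowsub (pair_sel i j) 1%:M) J.

(* Up to sign, the minor of J deleting the columns i and j *)
Definition cominor (i j : 'I_c) : D := \det (bordered i j).

(** As [J *m V = 0], the product of [bordered i j] with [row_mx V Y] is block upper triangular. *)
Lemma bordered_mul i j (V : 'M[D]_(c, 2)) (Y : 'M_(c, r)) :
  J *m V = 0 -> \det (rowsub (pair_sel i j) V) * \det (J *m Y) =
    cominor i j * \det (row_mx V Y).
Proof.
move=> JV; rewrite -det_mulmx mul_col_row JV det_ublock mul_rowsub_mx mul1mx.
by [].
Qed.

(** Both determinants involving [Y] are independent of [i] and [j], so this is a proportionality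
    between v /\ w and the vector of cominors. *)
Lemma wedge_cominor i j (v w : 'cV[D]_c) (Y : 'M_(c, r)) :
  J *m v = 0 -> J *m w = 0 ->
  wedge v w i j * \det (J *m Y) =
    cominor i j * \det (row_mx (row_mx v w : 'M_(c, 1 + 1)) Y).
Proof.
move=> Jv Jw; rewrite -bordered_mul; last first.
  by rewrite (mul_mx_row J v w) Jv Jw row_mx0.
congr (_ * _); rewrite det2 /wedge.
by rewrite ![rowsub _ _ _ _]mxE !row_mx2E0 !row_mx2E1 /= [v j 0 * _]mulrC.
Qed.

(** Take [i] and [j] outside the image of [h]: multiplying [bordered i j] by the columns of the
    identity selected by [i], [j] and [h] gives a block lower triangular matrix with determinant the
    minor. *)
Lemma colsub_cominor (h : 'I_r -> 'I_c) :
  exists i j, divides (cominor i j) (\det (colsub h J)).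
Proof.
have /card_gt1P [i [j [hi hj ne]]] : (1 < #|~: (h @: setT)|)%N.
  rewrite -(ltn_add2l #|h @: setT|) cardsC card_ord.
  by rewrite addn1 !ltnS (leq_trans (leq_imset_card _ _)) // cardsT card_ord.
exists i, j; exists (\det (row_mx (colsub (pair_sel i j) 1%:M) (colsub h 1%:M))).
rewrite mulrC /cominor -det_mulmx mul_col_row !mul_rowsub_mx !mul1mx.
rewrite !mulmx_colsub !mulmx1.
have -> : rowsub (pair_sel i j) (colsub h 1%:M) = 0 :> 'M[D]_(2, r).
  apply/matrixP => a b; rewrite !mxE /pair_sel.
  have hb : h b \in h @: setT by exact: imset_f.
  by case: ifP => _; case: eqP => // e; [move: hi | move: hj]; rewrite inE e hb.
have -> : rowsub (pair_sel i j) (colsub (pair_sel i j) 1%:M) = 1%:M :> 'M[D]_2.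
  apply/matrixP => a b; rewrite !mxE /pair_sel.
  case: a => [] [|[|//]] ?; case: b => [] [|[|//]] ?; rewrite /= ?eqxx //.
    by rewrite (negPf ne).
  by rewrite eq_sym (negPf ne).
by rewrite det_lblock det1 mul1r.
Qed.

Lemma bordered0 i j l : bordered i j 0 l = (i == l)%:R.
Proof.
have -> : 0 = lshift r 0 :> 'I_c by apply: val_inj.
by rewrite col_mxEu !mxE.
Qed.

Lemma bordered1 i j l : bordered i j (lift 0 (0 : 'I_r.+1)) l = (j == l)%:R.
Proof.
have -> : lift 0 0 = lshift r 1 :> 'I_c by apply: val_inj.
by rewrite col_mxEu !mxE.
Qed.

Lemma bordered2 i j a l : bordered i j (lift 0 (lift 0 a : 'I_r.+1)) l = J a l.
Proof.
have -> : lift 0 (lift 0 a) = rshift 2 a :> 'I_c by apply: val_inj.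
by rewrite col_mxEd.
Qed.

(** Expanding along the two unit rows leaves the columns other than [i] and [j], in increasing
    order, with a sign [q]. *)
Lemma cominor_minor i j : i != j -> exists (h : 'I_r -> 'I_c) q,
  {homo h : a b / (a < b)%N} /\ cominor i j = q * \det (colsub h J).
Proof.
case: (unliftP i j) => [j' ->|->]; last by rewrite eqxx.
move=> ne; exists (fun a => lift i (lift j' a)).
have lift_homo m (x : 'I_m) (a b : 'I_m.-1) : (a < b)%N -> (lift x a < lift x b)%N.
  move=> ab; rewrite /= /bump -addnS; apply: leq_add => //.
  by case: (leqP x a) => // xa; rewrite (leq_trans xa (ltnW ab)).
rewrite /cominor (expand_det_row (bordered i (lift i j') : 'M_r.+2) 0).
rewrite (bigD1 i) //= big1 ?addr0 => [|l li]; last first.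
  by rewrite bordered0 eq_sym (negPf li) mul0r.
rewrite bordered0 eqxx mul1r /cofactor.
set A := row' _ _; rewrite (expand_det_row A 0).
have A0 l : A 0 l = (j' == l)%:R.
  by rewrite 2!mxE bordered1 (inj_eq lift_inj).
rewrite (bigD1 (j' : 'I_r.+1)) //= big1 ?addr0 => [|l lj]; last first.
  by rewrite A0 eq_sym (negPf lj) mul0r.
rewrite A0 eqxx mul1r /cofactor.
set B := row' _ _; have -> : B = colsub (fun a => lift i (lift j' a)) J.
  apply/matrixP => a b; rewrite [RHS]mxE -(bordered2 i (lift i j')).
  by do 4 rewrite [LHS]mxE.
eexists; split; last by rewrite mulrA.
by move=> a b ab; apply: (lift_homo) => //; apply: (lift_homo).
Qed.

Lemma cominor_alternate i : cominor i i = 0.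
Proof.
apply: (@determinant_alternate _ _ _ (0 : 'I_r.+2) (lift 0 0)) => // l.
by rewrite bordered0 bordered1.
Qed.

(** All is read off the adjugate of [bordered k l]: its first two columns lie in the kernel of [J],
    the others form [Y]. The vector [v] is the second column, whose coordinates at [k] and [l] are 0
    and the cominor. *)
Lemma cominor_kernel k l : exists (Y : 'M_(c, r)) (v : 'cV_c),
  [/\ J *m Y = (cominor k l)%:M, J *m v = 0
    & forall e, wedge e v k l = e k 0 * cominor k l].
Proof.
pose X : 'M[D]_(c, 2 + r) := \adj (bordered k l).
have := mul_mx_adj (bordered k l); rewrite -/(cominor k l) -/X -[X]hsubmxK.
rewrite mul_col_row (scalar_mx_block 2 r (cominor k l)) => /eq_block_mx [EV _ JV JY].
exists (rsubmx X), (col 1 (lsubmx X)); split=> //.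
  by rewrite colE mulmxA JV mul0mx.
rewrite mul_rowsub_mx mul1mx in EV.
have E a : lsubmx X (pair_sel k l a) 1 = (cominor k l)%:M a 1 by rewrite -EV [RHS]mxE.
move=> e; have := E 0; have := E 1; rewrite /pair_sel /= => E1 E0.
by rewrite /wedge ![col _ _ _ _]mxE E0 E1 !mxE /= mulr0 subr0.
Qed.

End Minors.

(** * Kernel vectors through their wedge with [e] *)

Section WedgeKernel.
Variables (D : idomainType) (r : nat) (J : 'M[D]_(r, 2 + r)).
Variables (e : 'cV[D]_(2 + r)) (k l : 'I_(2 + r)).
Hypotheses (Je : J *m e = 0) (ek : e k 0 != 0) (Jkl : cominor J k l != 0).

(* The kernel has rank two, so some element of it has nonzero wedge with e,   *)
(* necessarily proportional to the vector of cominors.                        *)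
Lemma wedge_proportional : exists (v : 'cV[D]_(2 + r)) a b,
  [/\ a != 0, b != 0, J *m v = 0 & forall i j, wedge e v i j * a = cominor J i j * b].
Proof.
have [Y [v [JY Jv wv]]] := cominor_kernel J k l.
pose a := cominor J k l ^+ r.
have wE i j := wedge_cominor i j Y Je Jv.
exists v, a, (\det (row_mx (row_mx e v : 'M_(2 + r, 1 + 1)) Y)).
have a0 : a != 0 by rewrite expf_neq0.
split=> //; last by move=> i j; rewrite -wE JY det_scalar.
apply: contra_neq (mulf_neq0 (mulf_neq0 ek Jkl) a0) => b0.
by rewrite -wv -[a]det_scalar -JY wE b0 mulr0.
Qed.

(** The identity e /\ (e /\ v) = 0, carried over to the cominors by proportionality. *)
Lemma cominor_koszul i j m :
  e i 0 * cominor J j m - e j 0 * cominor J i m + e m 0 * cominor J i j = 0.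
Proof.
have [v [a [b [_ b0 _ h]]]] := wedge_proportional.
apply: (mulIf b0); rewrite mul0r mulrDl mulrBl -!mulrA -!h /wedge.
ring.
Qed.

Lemma kernel_wedge (g : D) (w : 'I_(2 + r) -> 'I_(2 + r) -> D) v :
  factorial_domain D -> (forall i j, cominor J i j = w i j * g) ->
  (forall q, (forall i j, divides q (w i j)) -> q \is a GRing.unit) ->
  J *m v = 0 -> exists h, forall i j, wedge e v i j = h * w i j.
Proof.
move=> fD wg prim Jv; have [Y [_ [JY _ _]]] := cominor_kernel J k l.
have a0 : cominor J k l ^+ r != 0 by rewrite expf_neq0.
have wE i j := wedge_cominor i j Y Je Jv.
move: wE; rewrite JY det_scalar; set b := \det _ => wE.
have [h hE] : divides (cominor J k l ^+ r) (g * b).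
  apply: (prime_factored_gauss (b := fun ij => w ij.1 ij.2) (fD _ a0)).
    by move=> q qw; apply: prim => i j; exact: (qw (i, j)).
  by move=> [i j] /=; exists (wedge e v i j); rewrite wE wg; ring.
exists h => i j; apply: (mulIf a0); rewrite wE wg -mulrA hE; ring.
Qed.

(** With [v] in the kernel as in [wedge_proportional], [a *: v] and [(b * g) *: w] have the same
    wedge with [e], so they differ by a multiple of [e], which [J] kills. *)
Lemma kernel_of_wedge (g : D) (w : 'cV[D]_(2 + r)) :
  (forall v, (forall i j, wedge e v i j = 0) -> exists q, v = q *: e) ->
  g != 0 -> (forall i j, cominor J i j = wedge e w i j * g) -> J *m w = 0.
Proof.
move=> koszul g0 wg; have [v [a [b [_ b0 Jv h]]]] := wedge_proportional.
have [q eq] : exists q, a *: v - (b * g) *: w = q *: e.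
  apply: koszul => i j; have := h i j; rewrite wg /wedge !mxE => E.
  transitivity ((e i 0 * v j 0 - e j 0 * v i 0) * a
     - (e i 0 * w j 0 - e j 0 * w i 0) * g * b); first by ring.
  by rewrite E subrr.
have : (b * g) *: (J *m w) = 0.
  rewrite scalemxAr; have -> : (b * g) *: w = a *: v - q *: e by rewrite -eq opprB addrC subrK.
  by rewrite mulmxBr -!scalemxAr Jv Je !scaler0 subrr.
by move/eqP; rewrite scalemx_eq0 mulf_eq0 (negPf b0) (negPf g0) => /eqP.
Qed.

End WedgeKernel.

(** * A basis of the kernel of the Jacobian matrix *)

Lemma pihomog_varM (R : idomainType) n (i : 'I_n) d (a : {mpoly R[n]}) :
  pihomog mdeg d ('X_i * a) = if d is d'.+1 then 'X_i * pihomog mdeg d' a else 0.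
Proof.
rewrite {1}[a]mpolyE mulr_sumr raddf_sum /=; case: d => [|d].
  apply: big1 => m _; rewrite -scalerAr -mpolyXD linearZ /= pihomogX /= mdegD mdeg1.
  by rewrite scaler0.
rewrite [in RHS](mpolyE a) raddf_sum mulr_sumr; apply: eq_bigr => m _ /=.
rewrite -scalerAr -mpolyXD !linearZ /= -scalerAr !pihomogX /= mdegD mdeg1 add1n eqSS.
by case: eqP => _; rewrite ?mpolyXD ?mulr0.
Qed.

Lemma dhomog_det (R : idomainType) n m (A : 'M[{mpoly R[n]}]_m) (D : 'I_m -> nat) :
  (forall i j, A i j \is (D i).-homog) -> \det A \is (\sum_i D i).-homog.
Proof.
move=> hA; apply: rpred_sum => s _; rewrite mulr_sign.
suff h : \prod_i A i (s i) \is (\sum_i D i).-homog by case: ifP; rewrite ?rpredN.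
elim/big_rec2: _ => [|i d q _ hq]; first exact: dhomog1.
exact: dhomogM.
Qed.

Lemma rank_cominor (D : idomainType) r (J : 'M[D]_(r, 2 + r)) :
  rank_frac J = r -> exists i j, cominor J i j != 0.
Proof.
move=> rk; have full : row_full (map_mx (@FracField.tofrac D) J)^T.
  by rewrite /row_full mxrank_tr; apply/eqP.
have := fullrowsub_unit full; set f := fullrankfun full.
rewrite unitmxE unitfE => nz.
have [i [j [q e]]] := colsub_cominor J f; exists i, j; apply: contraNneq nz => z.
have -> : rowsub f (map_mx (@FracField.tofrac D) J)^T
    = map_mx (@FracField.tofrac D) (colsub f J)^T.
  by apply/matrixP => a b; rewrite !mxE.
by rewrite det_map_mx det_tr e z mulr0 rmorph0.
Qed.

Definition euler_vec (R : idomainType) n : 'cV[{mpoly R[n]}]_n := \col_i 'X_i.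

Section KernelBasis.
Variables (k : fieldType) (p r : nat) (sigma : r.-tuple {mpoly k[2 + r]}).
Variable g : {mpoly k[2 + r]}.
Hypotheses (p_char : p \in [pchar k]) (r_gt0 : (0 < r)%N).
Notation deg i := (mpdeg (tnth sigma i)).
Notation S := {mpoly k[2 + r]}.
Notation J := (jacobian sigma).
Notation e := (euler_vec k (2 + r)).
Hypothesis sigma_homog : forall i, tnth sigma i \is (deg i).-homog.
Hypothesis sigma_rank : rank_frac J = r.
Hypothesis p_dvd_deg : forall i, (p %| deg i)%N.
Hypothesis g_gcd : is_gcd (maximal_minor J) g.

Lemma jacobian_euler : J *m e = 0.
Proof.
apply/matrixP => i j; rewrite !mxE.
transitivity ((tnth sigma i) *+ deg i); last first.
  have /dvdnP [q ->] := p_dvd_deg i; rewrite mulnC mulrnA.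
  by rewrite -[_ *+ p]scaler_nat (pcharf0 p_char) scale0r mul0rn.
rewrite -(euler (sigma_homog i)).
by apply: eq_bigr => l _; rewrite !mxE.
Qed.

Lemma cominor_homog i j : cominor J i j \is (\sum_(l < r) (deg l).-1).-homog.
Proof.
(* Degrees of the rows of the bordered matrix: 0 for the unit rows, those of the derivatives for the
   rows of [J]. *)
pose D (a : 'I_(2 + r)) := if split a is inr l then (deg l).-1 else 0%N.
have -> : (\sum_(l < r) (deg l).-1 = \sum_a D a)%N.
  rewrite big_split_ord /= [X in (_ = X + _)%N]big1 => [|a _].
    by rewrite add0n; apply: eq_bigr => l _; rewrite /D (unsplitK (inr l)).
  by rewrite /D (unsplitK (inl a)).
apply: dhomog_det => a b; rewrite /D /bordered mxE.
case: (split a) => [a'|l]; rewrite !mxE.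
  by case: eqP => _; [exact: dhomog1 | exact: dhomog0].
by apply: dhomog_mderiv; exact: sigma_homog.
Qed.

(** A constant in [sigma] would give [J] a zero row and kill all cominors. Positivity makes the
    truncated predecessors in [cominor_homog] true differences. *)
Lemma deg_gt0 i : (0 < deg i)%N.
Proof.
rewrite lt0n; apply/eqP => d0; have [a [b /eqP []]] := rank_cominor sigma_rank.
rewrite /cominor (expand_det_row _ (rshift 2 i)) big1 // => j _.
rewrite /bordered col_mxEd mxE dhomog_mderiv0 ?mul0r //.
by have := sigma_homog i; rewrite d0.
Qed.

Lemma gcd_cominor : exists w : 'I_(2 + r) -> 'I_(2 + r) -> S,
  forall i j, cominor J i j = w i j * g.
Proof.
have [gdiv _] := g_gcd.
have h (ij : 'I_(2 + r) * 'I_(2 + r)) : divides g (cominor J ij.1 ij.2).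
  case: ij => i j /=; have [->|ne] := eqVneq i j.
    by exists 0; rewrite cominor_alternate mul0r.
  have [f [q [fh ->]]] := cominor_minor J ne.
  by apply: divides_mull; apply: gdiv; exists f.
have [w hw] := fin_all_exists h.
by exists (fun i j => w (i, j)) => i j; rewrite -hw.
Qed.

Lemma koszul_wedge_eq0 (v : 'cV[S]_(2 + r)) :
  (forall i j, wedge e v i j = 0) -> exists q, v = q *: e.
Proof.
move=> h; have [|q hq] := @koszul1 k (2 + r) r_gt0 (fun i => v i 0).
  by move=> i j; have := h i j; rewrite /wedge !mxE => /eqP; rewrite subr_eq0 => /eqP.
by exists q; apply/matrixP => i j; rewrite (ord1 j) hq !mxE.
Qed.

Lemma kernel_basis : exists (w : 'cV[S]_(2 + r)) (d : nat),
  [/\ d%:Z = \sum_i (deg i)%:Z - r%:Z - (mpdeg g)%:Z - 1,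
      J *m w = 0, forall l, w l 0 \is d.-homog,
      exists i j, wedge e w i j != 0
    & forall v, J *m v = 0 -> exists a b, v = a *: e + b *: w].
Proof.
have [k0 [l0 nz]] := rank_cominor sigma_rank; have Je := jacobian_euler.
have ek : e k0 0 != 0 by rewrite mxE -msupp_eq0 msuppX.
have [w wg] := gcd_cominor.
have := nz; rewrite wg mulf_eq0 negb_or => /andP[w0 g0].
(* If [q] divides all [w i j], then [q * g] divides every maximal minor, hence divides [g]. *)
have prim q : (forall i j, divides q (w i j)) -> q \is a GRing.unit.
  move=> qw; have [_ /(_ (q * g)) []] := g_gcd.
    move=> _ [f [_ ->]]; have [i [j]] := colsub_cominor J f; apply: divides_trans.
    by have [s es] := qw i j; exists s; rewrite wg es mulrA.
  move=> s es; apply/unitrP; exists s.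
  have sq : s * q = 1 by apply: (mulIf g0); rewrite mul1r -mulrA -es.
  by split=> //; rewrite mulrC.
have [|u wu] := @koszul2 k (2 + r) r_gt0 w.
  move=> i j l; apply: (mulIf g0); rewrite mul0r.
  have := cominor_koszul Je ek nz i j l; rewrite !wg !mxE => h.
  by rewrite -[RHS]h; ring.
have [dw [dg [hw hg dE]]] : exists dw dg, [/\ w k0 l0 \is dw.-homog, g \is dg.-homog
    & (dw + dg = \sum_(l < r) (deg l).-1)%N].
  by apply: dhomog_factorl; rewrite -wg //; exact: cominor_homog.
have wh i j : w i j \is dw.-homog.
  have [->|nzw] := eqVneq (w i j) 0; first exact: dhomog0.
  have nzc : w i j * g != 0 by rewrite mulf_neq0.
  have := cominor_homog i j; rewrite wg => /(dhomog_factorl nzc).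
  move=> [dw' [dg' [hw' hg' dE']]]; suff -> : dw = dw' by [].
  by apply/eqP; rewrite -(eqn_add2r dg) dE -dE' (dhomog_uniq g0 hg hg').
(* The Koszul preimage [u] need not be homogeneous; its component of degree [dw - 1] is still a
   preimage. The case [dw = 0] is excluded, as e /\ u has no constant term. *)
have pw i j : w i j = pihomog mdeg dw ('X_i * u j - 'X_j * u i).
  by rewrite -wu pihomog_dE.
case: dw => [|d] in hw dE wh pw *.
  by move: w0; rewrite pw linearB /= !pihomog_varM subrr eqxx.
pose v : 'cV[S]_(2 + r) := \col_j pihomog mdeg d (u j).
have wv i j : wedge e v i j = w i j.
  by rewrite /wedge !mxE pw linearB /= !pihomog_varM.
have Jv : J *m v = 0.
  apply: (kernel_of_wedge Je ek nz koszul_wedge_eq0 g0) => i j.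
  by rewrite wv wg.
exists v, d; split=> //.
- have -> : mpdeg g = dg.
    by apply: (dhomog_uniq g0 _ hg); exact: dhomog_msize hg.
  have : (\sum_(l < r) (deg l).-1 + r = \sum_(l < r) deg l)%N.
    rewrite -[r in (_ + r)%N]card_ord -sum1_card -big_split /=.
    by apply: eq_bigr => l _; rewrite addn1 prednK // deg_gt0.
  rewrite -dE -(big_morph Posz PoszD (erefl 0%:Z)) => <-.
  by lia.
- by move=> l; rewrite mxE; exact: pihomogP.
- by exists k0, l0; rewrite wv.
(* Here e /\ x = b (e /\ v), so x - b v is a multiple of e. *)
move=> x Jx; have [b hb] := kernel_wedge Je nz (@factorial_mpoly k _) wg prim Jx.
have [|a ha] := koszul_wedge_eq0 (v := x - b *: v).
  move=> i j; have := hb i j; rewrite -wv /wedge !mxE => E.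
  transitivity (('X_i * x j 0 - 'X_j * x i 0) -
     b * ('X_i * pihomog mdeg d (u j) - 'X_j * pihomog mdeg d (u i))); first by ring.
  by rewrite E subrr.
by exists a, b; rewrite -ha subrK.
Qed.

End KernelBasis.

(** * The splitting of sheaves *)

Section Sheaf.
Variables (k : fieldType) (n : nat).
Notation S := {mpoly k[n.+1]}.
Notation K := {fraction S}.
Notation to_frac := (map_mx (@FracField.tofrac S)).

Lemma common_denominator m U (s : Pn k n -> 'cV[K]_m) x : zariski_open U ->
  (forall i, twist_section 0 U (fun y => s y i 0)) -> U x ->
  exists V (A : 'cV[S]_m) b D,
  [/\ [/\ zariski_open V, V x & included V U],
      forall i, A i 0 \is D.-homog, b \is D.-homog
    & forall y, V y -> ~ y b /\ s y = (b%:F)^-1 *: to_frac A].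
Proof.
move=> oU hs Ux.
(* Restricting the claim to a list of indices allows an induction that multiplies in one denominator
   at a time. *)
suff: exists V (A : 'cV[S]_m) b D,
  [/\ [/\ zariski_open V, V x & included V U],
      forall i, A i 0 \is D.-homog, b \is D.-homog
    & forall y, V y -> ~ y b /\
        forall i, i \in index_enum 'I_m -> s y i 0 = (A i 0)%:F / b%:F].
  move=> [V [A [b [D [oV hA hb h]]]]]; exists V, A, b, D; split=> // y /h [yb sy].
  split=> //; apply/matrixP => i j; rewrite (ord1 j) !mxE sy ?mem_index_enum //.
  by rewrite mulrC.
elim: (index_enum _) => [|j js [V [A [b [D [[oV Vx sVU] hA hb h]]]]]].
  exists U, 0, 1, 0%N; split.
  - by split=> // y.
  - by move=> i; rewrite mxE rpred0.
  - exact: dhomog1.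
  - by move=> y _; split=> //; exact: pt_proper.
have [W [oW Wx _ [a' [b' [da [db [ha hb' dE h']]]]]]] := hs j _ Ux.
have {}dE : da = db by move: dE; rewrite addr0 => -[].
exists (fun y => V y /\ W y), (\col_i if i == j then a' * b else A i 0 * b').
exists (b * b'), (D + db)%N; split.
- split=> //; first exact: zariski_openI.
  by move=> y [/sVU].
- move=> i; rewrite mxE; case: ifP => _; last exact: dhomogM.
  by rewrite -dE addnC; exact: dhomogM.
- exact: dhomogM.
move=> y [/h [yb sy] /h' [yb' sy']]; split; first by case/pt_prime.
have b0 := pt_neq0 yb; have b'0 := pt_neq0 yb'.
move=> i; rewrite inE mxE !tofracM; case: eqP => [-> _|_ /= /sy ->].
  by rewrite sy' tofracM (mulrC b%:F) -mulf_div divff // mulr1.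
by rewrite !tofracM -mulf_div divff // mulr1.
Qed.

Section Splitting.
Variables (r : nat) (sigma : r.-tuple {mpoly k[n.+1]}).
Hypothesis sigma_homog :
  forall i : 'I_r, tnth sigma i \is (mpdeg (tnth sigma i)).-homog.
Notation J := (jacobian sigma).
Notation e := (euler_vec k n.+1).
Variables (w : 'cV[S]_n.+1) (d : nat) (i0 j0 : 'I_n.+1).
Hypotheses (Je : J *m e = 0) (Jw : J *m w = 0).
Hypothesis w_homog : forall l, w l 0 \is d.-homog.
Hypothesis ew_neq0 : wedge e w i0 j0 != 0.
Hypothesis span : forall v, J *m v = 0 -> exists a b, v = a *: e + b *: w.

Let basis : 'M[S]_(n.+1, 2) := row_mx e w.
(** A left inverse of [basis] over the fraction field, obtained by inverting the rows [i0] and [j0],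
    whose minor is [wedge e w i0 j0]. *)
Let coords : 'M[K]_(2, n.+1) :=
  invmx (rowsub (pair_sel i0 j0) (to_frac basis)) *m rowsub (pair_sel i0 j0) 1%:M.

Lemma coordsK : coords *m to_frac basis = 1%:M.
Proof.
rewrite -mulmxA mul_rowsub_mx mul1mx mulVmx //.
have -> : rowsub (pair_sel i0 j0) (to_frac basis)
    = to_frac (rowsub (pair_sel i0 j0) basis) by apply/matrixP => a b; rewrite !mxE.
rewrite unitmxE unitfE det_map_mx /= tofrac_eq0 det2.
have := ew_neq0; rewrite /wedge [e j0 0 * _]mulrC.
by rewrite ![rowsub _ _ _ _]mxE !row_mx2E0 !row_mx2E1.
Qed.

Lemma basis_mul (t : 'cV[K]_2) :
  to_frac basis *m t = t 0 0 *: to_frac e + t 1 0 *: to_frac w.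
Proof.
apply/matrixP => i j; rewrite (ord1 j) mxE !big_ord_recl big_ord0 addr0.
rewrite ![to_frac basis _ _]mxE row_mx2E0.
have -> : lift ord0 ord0 = 1 :> 'I_2 by apply: val_inj.
by rewrite row_mx2E1 !mxE mulrC [X in _ + X]mulrC.
Qed.

(** The numerator of a local section is a kernel vector over [S], so [span] applies. Zero
    coefficients are set apart because [D] may be too small for a degree [D - 1] or [D - d] to
    exist. *)
Lemma kernel_section_coords U s x : zariski_open U ->
  osec (log_tangent_sheaf sigma_homog) U s -> U x ->
  exists V (a h b : S) da dh D,
  [/\ [/\ zariski_open V, V x & included V U],
      (a = 0 \/ a \is da.-homog /\ (da + 1 = D)%N),
      (h = 0 \/ h \is dh.-homog /\ (dh + d = D)%N), b \is D.-homog
    & forall y, V y -> ~ y b /\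
        s y = (b%:F)^-1 *: (a%:F *: to_frac e + h%:F *: to_frac w)].
Proof.
move=> oU [hs Js] Ux.
have [|V [A [b [D [[oV Vx sVU] hA hb hV]]]]] := common_denominator (s := s) oU _ Ux.
  by move=> i; have := hs i; rewrite tnth_mktuple.
have [xb sx] := hV _ Vx; have b0 := pt_neq0 xb.
have JA : J *m A = 0.
  have := Js _ Ux; rewrite /= /nabla_map sx -scalemxAr -map_mxM => /eqP.
  rewrite scalemx_eq0 invr_eq0 (negPf b0) /= => /eqP JA0.
  apply/matrixP => i j; apply/eqP; rewrite [X in _ == X]mxE -tofrac_eq0.
  by have := congr1 (fun M : 'cV_r => M i j) JA0; rewrite !mxE => ->.
have [a [h hA']] := span JA.
have Ai i : A i 0 = a * 'X_i + h * w i 0 by rewrite hA' !mxE.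
have hX i : ('X_i : S) \is 1.-homog by rewrite dhomogX /= mdeg1.
have hew : wedge e w i0 j0 \is (1 + d).-homog.
  by rewrite /wedge !mxE rpredB // dhomogM.
(* Cramer's rule: for A = a e + h w, A /\ w = a (e /\ w) and e /\ A = h (e /\ w). Factors of a
   nonzero homogeneous polynomial being homogeneous, so are [a] and [h]. *)
have ha : a * wedge e w i0 j0 \is (D + d).-homog.
  have -> : a * wedge e w i0 j0 = wedge A w i0 j0 by rewrite /wedge !Ai !mxE; ring.
  by rewrite rpredB // dhomogM.
have hh : h * wedge e w i0 j0 \is (1 + D).-homog.
  have -> : h * wedge e w i0 j0 = wedge e A i0 j0 by rewrite /wedge !Ai !mxE; ring.
  by rewrite /wedge !mxE rpredB // dhomogM.
have factor c N : c * wedge e w i0 j0 \is N.-homog ->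
    c = 0 \/ exists dc, c \is dc.-homog /\ (dc + (1 + d) = N)%N.
  have [->|c0] := eqVneq c 0; first by left.
  move=> /(dhomog_factorl (mulf_neq0 c0 ew_neq0)) [dc [de [hc he <-]]].
  by right; exists dc; rewrite (dhomog_uniq ew_neq0 hew he).
have [da {}ha] : exists da, a = 0 \/ a \is da.-homog /\ (da + 1 = D)%N.
  have [->|[da [hda dE]]] := factor _ _ ha; first by exists 0%N; left.
  by exists da; right; split=> //; lia.
have [dh {}hh] : exists dh, h = 0 \/ h \is dh.-homog /\ (dh + d = D)%N.
  have [->|[dh [hdh dE]]] := factor _ _ hh; first by exists 0%N; left.
  by exists dh; right; split=> //; lia.
exists V, a, h, b, da, dh, D; split=> // y /hV [yb ->]; split=> //.
by rewrite hA' map_mxD !map_mxZ.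
Qed.

Lemma kernel_sectionE U s x : zariski_open U ->
  osec (log_tangent_sheaf sigma_homog) U s -> U x ->
  to_frac basis *m (coords *m s x) = s x.
Proof.
move=> oU hs Ux.
have [V [a [h [b [_ [_ [_ [[_ Vx _] _ _ _ hV]]]]]]]] := kernel_section_coords oU hs Ux.
have [_ ->] := hV _ Vx; pose t : 'cV[K]_2 := \col_i pair_sel a%:F h%:F i.
have -> : a%:F *: to_frac e + h%:F *: to_frac w = to_frac basis *m t.
  by rewrite basis_mul !mxE.
by rewrite -!scalemxAr (mulmxA coords) coordsK mul1mx.
Qed.

Notation T := (log_tangent_sheaf sigma_homog).
Notation L := (twists k n [tuple -1; - (d%:Z)]).

Definition coord_map (U : Pn k n -> Prop) (s : Pn k n -> 'cV[K]_n.+1) :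
    Pn k n -> 'cV[K]_2 :=
  fun x => coords *m s x.

Definition combine_map (U : Pn k n -> Prop) (t : Pn k n -> 'cV[K]_2) :
    Pn k n -> 'cV[K]_n.+1 :=
  fun x => to_frac basis *m t x.

Lemma coord_map_sec U s : zariski_open U -> osec T U s -> osec L U (coord_map U s).
Proof.
move=> oU hs i x Ux.
have [V [a [h [b [da [dh [D [[oV Vx sVU] ha hh hb hV]]]]]]]] :=
  kernel_section_coords oU hs Ux.
have ft y : V y -> coord_map U s y i 0 = (pair_sel a h i)%:F / b%:F.
  move=> /hV [_ sy]; rewrite /coord_map sy.
  pose t : 'cV[K]_2 := \col_i pair_sel a%:F h%:F i.
  have -> : a%:F *: to_frac e + h%:F *: to_frac w = to_frac basis *m t.
    by rewrite basis_mul !mxE.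
  rewrite -scalemxAr mulmxA coordsK mul1mx !mxE mulrC; congr (_ * _).
  by rewrite /pair_sel; case: ifP.
have frac c dc m : (c = 0 \/ c \is dc.-homog /\ dc%:Z = D%:Z + m) ->
    (forall y, V y -> coord_map U s y i 0 = c%:F / b%:F) ->
    twist_section m V (fun y => coord_map U s y i 0).
  move=> [->|[hc dE]] hs'.
    by apply: twist_eq (twist0 m oV) => y /hs' ->; rewrite tofrac0 mul0r.
  move=> y Vy; exists V; split=> //; exists c, b, dc, D; split=> // z Vz.
  by have [zb _] := hV _ Vz; rewrite hs'.
suff /(_ x Vx) [W [oW Wx sWV hW]] : twist_section (tnth [tuple -1; - (d%:Z)] i) V
    (fun y => coord_map U s y i 0).
  by exists W; split=> // y /sWV /sVU.
case: i ft frac => [] [|[|//]] ? /= ft frac.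
  apply: (frac a da) => //; case: ha => [->|[ha dE]]; [by left | right].
    by split=> //; rewrite -dE (tnth_nth 0) /=; lia.
apply: (frac h dh) => //; case: hh => [->|[hh dE]]; [by left | right].
  by split=> //; rewrite -dE (tnth_nth 0) /=; lia.
Qed.

Lemma coord_map_res U V s t : zariski_open U -> zariski_open V -> included V U ->
  osec T U s -> osec T V t -> eq_on V s t -> eq_on V (coord_map U s) (coord_map V t).
Proof. by move=> _ _ _ _ _ st x Vx; rewrite /coord_map st. Qed.

Lemma coord_map_lin U c s t : zariski_open U -> twist_section 0 U c ->
  osec T U s -> osec T U t ->
  eq_on U (coord_map U (fun x => c x *: s x + t x))
          (fun x => c x *: coord_map U s x + coord_map U t x).
Proof. by move=> _ _ _ _ x _; rewrite /coord_map mulmxDr scalemxAr. Qed.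

(** The degrees 1 of ['X_l] and [d] of [w l 0] offset the twists -1 and -d. *)
Lemma combine_map_sec U t : zariski_open U -> osec L U t -> osec T U (combine_map U t).
Proof.
move=> oU ht; split=> [l|x _]; last first.
  rewrite /= /nabla_map /combine_map mulmxA -map_mxM.
  by rewrite (mul_mx_row J e w) Je Jw row_mx0 map_mx0 mul0mx.
rewrite tnth_mktuple.
have h0 : twist_section 0 U (fun x => (e l 0)%:F * t x 0 0).
  have := twistM (twist_poly (m := 1) oU (_ : 'X_l \is 1.-homog) erefl) (ht 0).
  by rewrite /= subrr => h; rewrite mxE; apply: h; rewrite dhomogX /= mdeg1.
have h1 : twist_section 0 U (fun x => (w l 0)%:F * t x 1 0).
  by have := twistM (twist_poly oU (w_homog l) erefl) (ht 1); rewrite /= subrr.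
apply: twist_eq (twistD h0 h1) => x _.
by rewrite /combine_map basis_mul !mxE mulrC [X in _ + X]mulrC.
Qed.

Lemma combine_map_res U V s t : zariski_open U -> zariski_open V -> included V U ->
  osec L U s -> osec L V t -> eq_on V s t ->
  eq_on V (combine_map U s) (combine_map V t).
Proof. by move=> _ _ _ _ _ st x Vx; rewrite /combine_map st. Qed.

Lemma combine_map_lin U c s t : zariski_open U -> twist_section 0 U c ->
  osec L U s -> osec L U t ->
  eq_on U (combine_map U (fun x => c x *: s x + t x))
          (fun x => c x *: combine_map U s x + combine_map U t x).
Proof. by move=> _ _ _ _ x _; rewrite /combine_map mulmxDr scalemxAr. Qed.

Lemma log_tangent_sheaf_split : oisomorphic T L.
Proof.
exists (OMorphism coord_map_sec coord_map_res coord_map_lin).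
exists (OMorphism combine_map_sec combine_map_res combine_map_lin).
move=> U oU; split=> [s hs|t _] x Ux; rewrite /= /coord_map /combine_map.
  exact: kernel_sectionE hs Ux.
by rewrite mulmxA coordsK mul1mx.
Qed.

End Splitting.
End Sheaf.

(** The constant ending [d] is -1, where the English formula has +1: omega has degree sum deg(f_i) -
    (n-1) - deg(g), and in omega = e /\ w the vector e takes up one degree. *)
Theorem theorem19 (k : fieldType) (p : nat) (p_char : p \in [pchar k])
    (n : nat) (n_ge2 : (2 <= n)%N)
    (sigma : n.-1.-tuple {mpoly k[n.+1]})
    (sigma_homog : forall i : 'I_n.-1,
      tnth sigma i \is (mpdeg (tnth sigma i)).-homog)
    (sigma_indep : alg_independent sigma)
    (sigma_rank : rank_frac (jacobian sigma) = n.-1)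
    (p_dvd_deg : forall i : 'I_n.-1, (p %| mpdeg (tnth sigma i))%N)
    (g : {mpoly k[n.+1]})
    (g_gcd : is_gcd (maximal_minor (jacobian sigma)) g) :
  let d : int :=
    \sum_(i < n.-1) (mpdeg (tnth sigma i))%:Z - (n.-1)%:Z - (mpdeg g)%:Z - 1 in
  oisomorphic (log_tangent_sheaf sigma_homog) (twists k n [tuple -1; - d]).
Proof.
(* With n = r + 2 the Jacobian matrix has r + 1 rows and 2 + (r + 1) columns, the shape of corank
   two treated by [kernel_basis]. *)
case: n n_ge2 sigma sigma_homog sigma_indep sigma_rank p_dvd_deg g g_gcd => [//|[//|r]].
move=> _ sigma sigma_homog _ sigma_rank p_dvd_deg g g_gcd d.
have [w [dw [dE Jw wh [i [j ew]] span]]] :=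
  kernel_basis p_char (ltn0Sn r) sigma_homog sigma_rank p_dvd_deg g_gcd.
have -> : d = dw%:Z by rewrite dE.
apply: (@log_tangent_sheaf_split k r.+2 _ sigma sigma_homog w dw i j _ Jw wh ew span).
exact: jacobian_euler p_char sigma_homog p_dvd_deg.
Qed.
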